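(* Each of the classes $\mathcal{E}$, $\mathcal{E}'$ and $\mathcal{E}''$ of magma homomorphisms is pullback stable: if $\alpha:A\to B$ belongs to the class and $f:B'\to B$ is any magma homomorphism, then the pullback $\alpha':A'\to B'$ of $\alpha$ along $f$ in the category of magmas belongs to the same class.
   Context: A (unitary) magma is a set $M$ with an element $0$ and a binary operation $+$ satisfying $0+x=x=x+0$ for all $x\in M$ (no other axiom). A magma homomorphism is a map preserving $0$ and $+$. Sums of maps are taken pointwise; $1$ denotes identity maps and $0$ also denotes constant zero maps. Split extension of magmas: a seven-tuple $E=(B,X,A,\alpha,\beta,\kappa,\lambda)$ where $B,X,A$ are magmas, $\alpha:A\to B$, $\beta:B\to A$, $\kappa:X\to A$ are magma homomorphisms, $\lambda:A\to X$ is a map with $\lambda(0)=0$ (not necessarily preserving addition), and, for all $x\in X$, $a\in A$, $b\in B$: $\lambda\kappa=1$, $\alpha\beta=1$; $\lambda\beta=0$, $\alpha\kappa=0$; $\kappa\lambda+\beta\alpha=1$; $\lambda(\kappa(x)+\beta(b))=x$; $\kappa(x)+(\beta(b)+a)=(\kappa(x)+\beta(b))+a$; $\kappa(x)+(a+\beta(b))=(\kappa(x)+a)+\beta(b)$; $a+(\kappa(x)+\beta(b))=(a+\kappa(x))+\beta(b)$. The associated action of $B$ on $X$ is $bx=\lambda(\beta(b)+\kappa(x))$. The split extension $E$ is called firm if $b'(bx)=(b'+b)x$ for all $b,b'\in B$, $x\in X$, for this associated action. $\mathcal{E}$ is the class of all magma homomorphisms $\alpha:A\to B$ for which there exists a split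 extension $(B,X,A,\alpha,\beta,\kappa,\lambda)$ with the same $\alpha$. $\mathcal{E}'$ is defined in the same way except that the split extension is required to be firm. $\mathcal{E}''$ is defined in the same way except that the split extension is required to be firm and its associated action is required to satisfy $b(x+x')=bx+bx'$ for all $b\in B$, $x,x'\in X$. *)

(* Defs.v *)
From HB Require Import structures.
From mathcomp Require Import all_boot ssralg.

Set Implicit Arguments.
Unset Strict Implicit.
Unset Printing Implicit Defensive.

Import GRing.Theory.
Local Open Scope ring_scope.

(* MathComp's [addUMagmaType] is commutative and carries a choice structure,
   so unitary magmas are built directly on [baseAddUMagmaType], which only
   provides [0] and [+].  Magma homomorphisms are then MathComp's
   [{additive A -> B}]: maps preserving [0] and [+]. *)
HB.mixin Record BaseAddUMagma_isUnitary M of Algebra.BaseAddUMagma M := {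
  zero_addl : left_id (0 : M) (@Algebra.add M);
  zero_addr : right_id (0 : M) (@Algebra.add M)
}.

#[short(type="unitaryMagmaType")]
HB.structure Definition UnitaryMagma :=
  {M of BaseAddUMagma_isUnitary M & Algebra.BaseAddUMagma M}.

Record is_split_extension (B X A : unitaryMagmaType)
    (alpha : {additive A -> B}) (beta : {additive B -> A})
    (kappa : {additive X -> A}) (lambda : A -> X) : Prop := IsSplitExtension {
  se_lambda0 : lambda 0 = 0;
  se_lambda_kappa : forall x, lambda (kappa x) = x;
  se_alpha_beta : forall b, alpha (beta b) = b;
  se_lambda_beta : forall b, lambda (beta b) = 0;
  se_alpha_kappa : forall x, alpha (kappa x) = 0;
  se_decomp : forall a, kappa (lambda a) + beta (alpha a) = a;
  se_lambda_add : forall x b, lambda (kappa x + beta b) = x;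
  se_assoc_kba : forall x b a,
    kappa x + (beta b + a) = (kappa x + beta b) + a;
  se_assoc_kab : forall x a b,
    kappa x + (a + beta b) = (kappa x + a) + beta b;
  se_assoc_akb : forall a x b,
    a + (kappa x + beta b) = (a + kappa x) + beta b
}.

Definition associated_action (B X A : unitaryMagmaType)
    (beta : {additive B -> A}) (kappa : {additive X -> A}) (lambda : A -> X)
    (b : B) (x : X) : X :=
  lambda (beta b + kappa x).

Definition firm_action (B X : unitaryMagmaType) (act : B -> X -> X) : Prop :=
  forall b' b x, act b' (act b x) = act (b' + b) x.

Definition additive_action (B X : unitaryMagmaType) (act : B -> X -> X) : Prop :=
  forall b x x', act b (x + x') = act b x + act b x'.

Definition hom_class : Type :=
  forall A B : unitaryMagmaType, {additive A -> B} -> Prop.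

(* The classes E, E' and E''. *)
Definition split_class : hom_class := fun A B alpha =>
  exists (X : unitaryMagmaType) (beta : {additive B -> A})
         (kappa : {additive X -> A}) (lambda : A -> X),
    is_split_extension alpha beta kappa lambda.

Definition firm_split_class : hom_class := fun A B alpha =>
  exists (X : unitaryMagmaType) (beta : {additive B -> A})
         (kappa : {additive X -> A}) (lambda : A -> X),
    is_split_extension alpha beta kappa lambda /\
    firm_action (associated_action beta kappa lambda).

Definition firm_additive_split_class : hom_class := fun A B alpha =>
  exists (X : unitaryMagmaType) (beta : {additive B -> A})
         (kappa : {additive X -> A}) (lambda : A -> X),
    [/\ is_split_extension alpha beta kappa lambda,
        firm_action (associated_action beta kappa lambda) &
        additive_action (associated_action beta kappa lambda)].

(* Since pullbacks are only determined up to isomorphism, they are given by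
   their universal property; morphisms are compared extensionally.

       A' --f'--> A
       |          |
     alpha'     alpha
       v          v
       B' --f---> B                                                        *)
Definition is_pullback (A B B' A' : unitaryMagmaType)
    (alpha : {additive A -> B}) (f : {additive B' -> B})
    (alpha' : {additive A' -> B'}) (f' : {additive A' -> A}) : Prop :=
  alpha \o f' =1 f \o alpha' /\
  forall (T : unitaryMagmaType) (u : {additive T -> A}) (v : {additive T -> B'}),
    alpha \o u =1 f \o v ->
    exists h : {additive T -> A'},
      [/\ f' \o h =1 u, alpha' \o h =1 v &
          forall h' : {additive T -> A'},
            f' \o h' =1 u -> alpha' \o h' =1 v -> h' =1 h].

Definition pullback_stable (C : hom_class) : Prop :=
  forall (A B B' A' : unitaryMagmaType)
         (alpha : {additive A -> B}) (f : {additive B' -> B})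
         (alpha' : {additive A' -> B'}) (f' : {additive A' -> A}),
    C A B alpha -> is_pullback alpha f alpha' f' -> C A' B' alpha'.

(* Main.v *)
From HB Require Import structures.
Require Import Defs.
From mathcomp Require Import all_boot ssralg.

(** Given a split extension of [B] by [X] with projection [alpha] and a
    pullback square

<<
       A' --f'--> A
       |          |
     alpha'     alpha
       v          v
       B' --f---> B
>>

    the pulled back split extension has the same kernel [X].  The universal
    property supplies its homomorphisms [beta'] and [kappa'] from the cones
    [(beta \o f, id)] and [(kappa, 0)], and its retraction [lambda'] is
    [lambda \o f'].  An identity in [A'] holds as soon as its images under [f']
    and [alpha'] do ([pullback_jointly_injective]); under [f'] each axiom
    becomes the same axiom of the given extension, and under [alpha'] it becomes
    an identity of [B'] whose kernel terms are [0], hence a unit law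
    ([pullback_is_split_extension]).  The action of [B'] on [X] is the action of
    [B] restricted along [f], so it inherits firmness and additivity
    ([pulled_back_split_extension]).

    Only uniqueness of mediating homomorphisms is at hand to show that [f'] and
    [alpha'] are jointly injective, so elements of [A'] are turned into
    homomorphisms: they correspond to the homomorphisms into [A'] from the free
    unitary magma on one generator. *)

Set Implicit Arguments.
Unset Strict Implicit.
Unset Printing Implicit Defensive.

Import GRing.Theory.
Local Open Scope ring_scope.

(** * The free unitary magma on one generator *)

Inductive magma_word := Generator | WordSum of magma_word & magma_word.

(** The nonzero elements are the bracketed sums of copies of the generator;
    [None] is the zero.  Each element has just one such form, because the unit
    laws allow zeros to be removed and no other law identifies two sums. *)
Definition free_magma := option magma_word.

Definition free_add (s t : free_magma) : free_magma :=
  match s, t with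
  | None, _ => t
  | _, None => s
  | Some v, Some w => Some (WordSum v w)
  end.

Lemma free_add0 : left_id None free_add.
Proof. by []. Qed.

Lemma free_addr0 : right_id None free_add.
Proof. by case. Qed.

HB.instance Definition _ := Algebra.hasAdd.Build free_magma free_add.
HB.instance Definition _ := Algebra.hasZero.Build free_magma None.
HB.instance Definition _ :=
  BaseAddUMagma_isUnitary.Build free_magma free_add0 free_addr0.

Fixpoint word_eval (M : unitaryMagmaType) (m : M) (w : magma_word) : M :=
  match w with
  | Generator => m
  | WordSum v w => word_eval m v + word_eval m w
  end.

Definition free_eval (M : unitaryMagmaType) (m : M) (s : free_magma) : M :=
  if s is Some w then word_eval m w else 0.

Lemma free_eval_is_nmod_morphism (M : unitaryMagmaType) (m : M) :
  nmod_morphism (free_eval m).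
Proof.
by split=> // -[v|] [w|] //=; rewrite ?zero_addl ?zero_addr.
Qed.

HB.instance Definition _ (M : unitaryMagmaType) (m : M) :=
  Algebra.isNmodMorphism.Build free_magma M (free_eval m)
    (free_eval_is_nmod_morphism m).

Lemma additive_free_eval (M N : unitaryMagmaType) (g : {additive M -> N})
    (m : M) : g \o free_eval m =1 free_eval (g m).
Proof.
case=> [w|] /=; last exact: raddf0.
by elim: w => //= v IHv w IHw; rewrite raddfD IHv IHw.
Qed.

(** * The zero homomorphism *)

Definition zero_hom (M N : unitaryMagmaType) of M : N := 0.

Lemma zero_hom_is_nmod_morphism (M N : unitaryMagmaType) :
  nmod_morphism (@zero_hom M N).
Proof. by split=> // x y; rewrite /zero_hom zero_addl. Qed.

HB.instance Definition _ (M N : unitaryMagmaType) :=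
  Algebra.isNmodMorphism.Build M N (@zero_hom M N)
    (zero_hom_is_nmod_morphism M N).

(** * Pullbacks of split extensions *)

(** The two elements yield homomorphisms from the free magma that mediate the
    same cone, hence agree at the generator. *)
Lemma pullback_jointly_injective (A B B' A' : unitaryMagmaType)
    (alpha : {additive A -> B}) (f : {additive B' -> B})
    (alpha' : {additive A' -> B'}) (f' : {additive A' -> A}) :
  is_pullback alpha f alpha' f' ->
  forall p q : A', f' p = f' q -> alpha' p = alpha' q -> p = q.
Proof.
case=> comm univ p q eqA eqB.
have cone : alpha \o (f' \o free_eval q) =1 f \o (alpha' \o free_eval q).
  by move=> s; exact: comm.
have [h [_ _ uniq_h]] := univ _ (f' \o free_eval q) (alpha' \o free_eval q) cone.
have p_h : free_eval p =1 h.
  by apply: uniq_h => s; rewrite additive_free_eval (eqA, eqB) -additive_free_eval.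
have q_h : free_eval q =1 h by exact: uniq_h.
exact: etrans (p_h (Some Generator)) (esym (q_h (Some Generator))).
Qed.

Lemma pullback_is_split_extension (A B X B' A' : unitaryMagmaType)
    (alpha : {additive A -> B}) (beta : {additive B -> A})
    (kappa : {additive X -> A}) (lambda : A -> X)
    (f : {additive B' -> B}) (alpha' : {additive A' -> B'})
    (f' : {additive A' -> A})
    (beta' : {additive B' -> A'}) (kappa' : {additive X -> A'}) :
  is_split_extension alpha beta kappa lambda ->
  is_pullback alpha f alpha' f' ->
  f' \o beta' =1 beta \o f -> alpha' \o beta' =1 id ->
  f' \o kappa' =1 kappa -> alpha' \o kappa' =1 @zero_hom X B' ->
  is_split_extension alpha' beta' kappa' (lambda \o f').
Proof.
move=> E pb f'beta alpha'beta f'kappa alpha'kappa.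
have eqA' := pullback_jointly_injective pb.
have comm a : alpha (f' a) = f (alpha' a) := pb.1 a.
have fb b : f' (beta' b) = beta (f b) := f'beta b.
have ab b : alpha' (beta' b) = b := alpha'beta b.
have fk x : f' (kappa' x) = kappa x := f'kappa x.
have ak x : alpha' (kappa' x) = 0 := alpha'kappa x.
split=> //=.
- by rewrite raddf0 (se_lambda0 E).
- by move=> x; rewrite fk (se_lambda_kappa E).
- by move=> b; rewrite fb (se_lambda_beta E).
- move=> a; apply: eqA'; rewrite raddfD.
  + by rewrite fk fb -comm (se_decomp E).
  + by rewrite ak ab zero_addl.
- by move=> x b; rewrite raddfD fk fb (se_lambda_add E).
- move=> x b a; apply: eqA'; rewrite !raddfD.
  + by rewrite fk fb (se_assoc_kba E).
  + by rewrite ak ab !zero_addl.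
- move=> x a b; apply: eqA'; rewrite !raddfD.
  + by rewrite fk fb (se_assoc_kab E).
  + by rewrite ak ab !zero_addl.
- move=> a x b; apply: eqA'; rewrite !raddfD.
  + by rewrite fk fb (se_assoc_akb E).
  + by rewrite ak ab zero_addl zero_addr.
Qed.

(** Besides the axioms, this records that the new action of [b'] on [X] is the
    old action of [f b']; firmness and additivity transfer through it. *)
Lemma pulled_back_split_extension (A B X B' A' : unitaryMagmaType)
    (alpha : {additive A -> B}) (beta : {additive B -> A})
    (kappa : {additive X -> A}) (lambda : A -> X)
    (f : {additive B' -> B}) (alpha' : {additive A' -> B'})
    (f' : {additive A' -> A}) :
  is_split_extension alpha beta kappa lambda ->
  is_pullback alpha f alpha' f' ->
  exists (beta' : {additive B' -> A'}) (kappa' : {additive X -> A'}),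
    is_split_extension alpha' beta' kappa' (lambda \o f') /\
    forall b x, associated_action beta' kappa' (lambda \o f') b x =
                associated_action beta kappa lambda (f b) x.
Proof.
move=> E pb; have [_ univ] := pb.
have beta_cone : alpha \o (beta \o f) =1 f \o idfun.
  by move=> b; exact: (se_alpha_beta E).
have kappa_cone : alpha \o kappa =1 f \o @zero_hom X B'.
  by move=> x; rewrite /= raddf0 (se_alpha_kappa E).
have [beta' [f'beta alpha'beta _]] := univ _ (beta \o f) idfun beta_cone.
have [kappa' [f'kappa alpha'kappa _]] := univ _ kappa (@zero_hom X B') kappa_cone.
exists beta', kappa'; split; first exact: pullback_is_split_extension E pb _ _ _ _.
move=> b x; rewrite /associated_action /= raddfD.
by rewrite [f' (beta' b)]f'beta [f' (kappa' x)]f'kappa.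
Qed.

Lemma restricted_action_firm (B B' X : unitaryMagmaType) (f : {additive B' -> B})
    (act : B -> X -> X) (act' : B' -> X -> X) :
  (forall b x, act' b x = act (f b) x) -> firm_action act -> firm_action act'.
Proof. by move=> act'E firm b' b x; rewrite !act'E firm raddfD. Qed.

Lemma restricted_action_additive (B B' X : unitaryMagmaType)
    (f : {additive B' -> B}) (act : B -> X -> X) (act' : B' -> X -> X) :
  (forall b x, act' b x = act (f b) x) ->
  additive_action act -> additive_action act'.
Proof. by move=> act'E addact b x x'; rewrite !act'E addact. Qed.

Theorem mainTheorem4 :
  [/\ pullback_stable split_class,
      pullback_stable firm_split_class &
      pullback_stable firm_additive_split_class].
Proof.
split=> A B B' A' alpha f alpha' f'.
- case=> X [beta [kappa [lambda E]]] pb.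
  have [beta' [kappa' [E' _]]] := pulled_back_split_extension E pb.
  by exists X, beta', kappa', (lambda \o f').
- case=> X [beta [kappa [lambda [E firm]]]] pb.
  have [beta' [kappa' [E' actE]]] := pulled_back_split_extension E pb.
  exists X, beta', kappa', (lambda \o f'); split=> //.
  exact: restricted_action_firm actE firm.
- case=> X [beta [kappa [lambda [E firm addact]]]] pb.
  have [beta' [kappa' [E' actE]]] := pulled_back_split_extension E pb.
  exists X, beta', kappa', (lambda \o f'); split=> //.
  + exact: restricted_action_firm actE firm.
  + exact: restricted_action_additive actE addact.
Qed.
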